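(* Consider the statistical manifold of Rayleigh distributions, with probability density functions $$p(x;\sigma)=\frac{x}{\sigma^2}\exp\left(-\frac{x^2}{2\sigma^2}\right),\qquad x\in[0,\infty),$$ parametrised by $\sigma\in(0,\infty)$. Its Fisher information is $g_{11}(\sigma)=\frac{4}{\sigma^2}$, and for all $\sigma_1,\sigma_2>0$ the Fisher--Rao distance is $$d_{\mathrm{FR}}(\sigma_1,\sigma_2)=2\,\left|\log\sigma_1-\log\sigma_2\right|.$$
   Context: For a parametric family $p_\xi=p(x;\xi)$ of probability densities with respect to Lebesgue measure, parametrised by $\xi$ in an open set $\Xi\subseteq\mathbb{R}^d$, the Fisher matrix is $G(\xi)=[g_{ij}(\xi)]$ with $g_{ij}(\xi)=\mathbb{E}_{p_\xi}\left[\frac{\partial\log p_\xi}{\partial\xi^i}\frac{\partial\log p_\xi}{\partial\xi^j}\right]$; when $d=1$ its single entry $g_{11}$ is called the Fisher information. The Fisher--Rao distance $d_{\mathrm{FR}}(\xi_1,\xi_2)$ is the infimum of the lengths $\int_0^1\sqrt{\dot\xi(t)^{\mathsf T}G(\xi(t))\dot\xi(t)}\,\mathrm{d}t$ over piecewise differentiable curves $\xi:[0,1]\to\Xi$ with $\xi(0)=\xi_1$, $\xi(1)=\xi_2$. *)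

(* Defs.v *)
From HB Require Import structures.
From mathcomp Require Import all_boot all_order all_algebra.
From mathcomp Require Import all_classical all_reals all_analysis.
From mathcomp Require Import measurable_realfun ring.
Set Implicit Arguments.
Unset Strict Implicit.
Unset Printing Implicit Defensive.
Import Order.TTheory GRing.Theory Num.Theory.
Import numFieldNormedType.Exports.
Local Open Scope classical_set_scope.
Local Open Scope ring_scope.

(* Parameters and tangent vectors are row vectors, so that the quadratic form
   written v^T G v for columns is v *m G *m v^T here. *)
Record densityFamily (R : realType) (d : nat) := DensityFamily {
  params : set 'rV[R]_d;
  sample : set R;
  density : 'rV[R]_d -> R -> R;
  params_open : open params;
  sample_measurable : measurable sample;
  density_measurable :
    forall xi, params xi -> measurable_fun sample (density xi);
  density_ge0 :
    forall xi x, params xi -> sample x -> 0 <= density xi x;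
  density_integral1 : forall xi, params xi ->
    (\int[lebesgue_measure]_(x in sample) (density xi x)%:E = 1)%E }.

Section FisherRao.
Variables (R : realType) (d : nat) (p : densityFamily R d).

Definition density_expectation (xi : 'rV[R]_d) (f : R -> R) : R :=
  \int[lebesgue_measure]_(x in sample p) (f x * density p xi x).

(* Partial derivative of log p(x; xi) in the i-th coordinate of xi.  Since
   ln 0 = 0 in the library, points where the density vanishes for all
   parameters contribute 0; they also have weight 0 in the expectation. *)
Definition score (i : 'I_d) (xi : 'rV[R]_d) (x : R) : R :=
  'D_(delta_mx 0 i) (fun eta : 'rV[R]_d => ln (density p eta x)) xi.

Definition fisher_matrix (xi : 'rV[R]_d) : 'M[R]_d :=
  \matrix_(i, j)
    density_expectation xi (fun x => score i xi x * score j xi x).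

(* Differentiability at t relative to D: one-sided at the end points of an
   interval D, the usual two-sided notion in its interior. *)
Definition derivable_within (D : set R) (c : R -> 'rV[R]_d) (t : R) : Prop :=
  cvg ((fun s => (s - t)^-1 *: (c s - c t)) @ within D t^').

(* The pieces are the closed intervals of a partition 0 = t_0 < ... < t_n = 1;
   the sequence s lists t_1, ..., t_n.  The derivative need not be continuous
   on the pieces. *)
Definition piecewise_differentiable (c : R -> 'rV[R]_d) : Prop :=
  {within `[0, 1], continuous c} /\
  exists2 s : seq R, itv_partition 0 1 s &
    forall k, (k < size s)%N ->
      let D := `[nth 0 (0 :: s) k, nth 0 (0 :: s) k.+1]%classic in
      forall t, D t -> derivable_within D c t.

(* A curve [0, 1] -> params is represented by a function on R whose values
   outside [0, 1] are irrelevant. *)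
Definition curve_between (xi1 xi2 : 'rV[R]_d) (c : R -> 'rV[R]_d) : Prop :=
  [/\ piecewise_differentiable c,
      forall t, 0 <= t <= 1 -> params p (c t),
      c 0 = xi1 & c 1 = xi2].

(* Lebesgue integral in [0, +oo], so that curves whose speed is not integrable
   have infinite length.  The speed at 0, 1 and at the break points, where the
   two-sided derivative may fail to exist, does not affect it. *)
Definition curve_length (c : R -> 'rV[R]_d) : \bar R :=
  (\int[lebesgue_measure]_(t in `[0%R, 1%R])
    (Num.sqrt ((derive1 c t *m fisher_matrix (c t) *m (derive1 c t)^T) 0 0))%:E)%E.

Definition fisher_rao_distance (xi1 xi2 : 'rV[R]_d) : \bar R :=
  ereal_inf [set curve_length c | c in curve_between xi1 xi2].

End FisherRao.

Definition fisher_information (R : realType) (p : densityFamily R 1)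
  (xi : 'rV[R]_1) : R := fisher_matrix p xi 0 0.

Section Rayleigh.
Variable R : realType.

Definition rayleigh_pdf (sigma x : R) : R :=
  x / sigma ^+ 2 * expR (- (x ^+ 2 / (2 * sigma ^+ 2))).

Definition rayleigh_params : set 'rV[R]_1 := [set xi | 0 < xi 0 0].

Definition rayleigh_sample : set R := `[0, +oo[.

Definition rayleigh_density (xi : 'rV[R]_1) (x : R) : R :=
  rayleigh_pdf (xi 0 0) x.

Lemma rayleigh_params_open : open rayleigh_params.
Proof.
rewrite (_ : rayleigh_params =
  (fun xi : 'rV[R]_1 => xi 0 0) @^-1` [set x | 0 < x]) //.
apply: open_comp; last exact: open_gt.
by move=> xi _; exact: coord_continuous.
Qed.

Let F (s x : R) : R := - expR (- (x ^+ 2 / (2 * s ^+ 2))).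

Lemma rayleigh_primitive_derive (s x : R) : 0 < s ->
  is_derive x 1 (F s) (rayleigh_pdf s x).
Proof.
move=> s0; rewrite /F /rayleigh_pdf.
have s0' : s ^+ 2 != 0 by rewrite expf_neq0// gt_eqF.
have H : is_derive x 1 (fun y : R => - (y ^+ 2 / (2 * s ^+ 2))) (- (x / s ^+ 2)).
  rewrite [X in is_derive _ _ X _](_ : _ =
    (- (2 * s ^+ 2)^-1) *: (@GRing.exp R ^~ 2)); last first.
    by apply/funext => y; rewrite /= [RHS]mulrC mulrN.
  by apply: is_derive_eq; rewrite /GRing.scale /=; field; rewrite gt_eqF.
apply: is_derive_eq; rewrite /GRing.scale /=.
by field; rewrite gt_eqF.
Qed.

Lemma rayleigh_pdf_continuous (s : R) : continuous (rayleigh_pdf s).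
Proof.
move=> x; rewrite /rayleigh_pdf; apply: cvgM.
  by apply: cvgM; [exact: cvg_id|exact: cvg_cst].
apply: continuous_comp; last exact: continuous_expR.
apply: cvgN; apply: cvgM; last exact: cvg_cst.
exact: exprn_continuous.
Qed.

Lemma rayleigh_pdf_ge0 (s x : R) : 0 <= x -> 0 <= rayleigh_pdf s x.
Proof.
by move=> x0; rewrite mulr_ge0 ?expR_ge0// divr_ge0// sqr_ge0.
Qed.

Lemma rayleigh_pdf_integral1 (s : R) : 0 < s ->
  (\int[lebesgue_measure]_(x in `[0%R, +oo[) (rayleigh_pdf s x)%:E = 1)%E.
Proof.
move=> s0.
rewrite (@ge0_continuous_FTC2y _ _ (F s) _ 0).
- by rewrite /F expr0n/= mul0r oppr0 expR0 -EFinB sub0r opprK.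
- by move=> x; exact: rayleigh_pdf_ge0.
- exact/continuous_subspaceT/rayleigh_pdf_continuous.
- rewrite /F -oppr0; apply: cvgN.
  apply: (@cvg_comp _ _ _ (fun x : R => x ^+ 2 / (2 * s ^+ 2))
    (fun z => expR (- z)) _ (pinfty_nbhs R)); last exact: cvgr_expR.
  apply: gt0_cvgMly; last exact: cvgr_expr2.
  by rewrite invr_gt0 mulr_gt0// exprn_gt0.
- by move=> x _; apply: ex_derive; exact: rayleigh_primitive_derive.
- apply: cvg_at_right_filter; apply: differentiable_continuous.
  apply/derivable1_diffP; apply: ex_derive; exact: rayleigh_primitive_derive.
- move=> x _; rewrite derive1E; apply: derive_val.
  exact: rayleigh_primitive_derive.
Qed.

Lemma rayleigh_density_measurable (xi : 'rV[R]_1) : rayleigh_params xi ->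
  measurable_fun rayleigh_sample (rayleigh_density xi).
Proof.
move=> _; apply: measurable_funTS; apply: continuous_measurable_fun.
exact: rayleigh_pdf_continuous.
Qed.

Lemma rayleigh_density_ge0 (xi : 'rV[R]_1) (x : R) :
  rayleigh_params xi -> rayleigh_sample x -> 0 <= rayleigh_density xi x.
Proof.
move=> _; rewrite /rayleigh_sample /= in_itv/= andbT => x0.
exact: rayleigh_pdf_ge0.
Qed.

Lemma rayleigh_density_integral1 (xi : 'rV[R]_1) : rayleigh_params xi ->
  (\int[lebesgue_measure]_(x in rayleigh_sample) (rayleigh_density xi x)%:E = 1)%E.
Proof. exact: rayleigh_pdf_integral1. Qed.

Lemma rayleigh_sample_measurable : measurable rayleigh_sample.
Proof. exact: measurable_itv. Qed.

Definition rayleigh : densityFamily R 1 :=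
  DensityFamily rayleigh_params_open rayleigh_sample_measurable
    rayleigh_density_measurable rayleigh_density_ge0
    rayleigh_density_integral1.

End Rayleigh.

(* Main.v *)
Require Import Defs.
From mathcomp Require Import all_boot all_order all_algebra.
From mathcomp Require Import all_classical all_reals all_analysis.
From mathcomp Require Import measurable_realfun ring lra.
Import Order.TTheory GRing.Theory Num.Theory.
Import numFieldNormedType.Exports.
Local Open Scope classical_set_scope.
Local Open Scope ring_scope.

(** The Fisher information comes from the score [x^2 / s^3 - 2 / s] and the
    substitution [u = x^2 / (2 s^2)], which turns the expectation of its square
    into [4 / s^2] times the integral of [(u - 1)^2 exp(- u)], a function with
    primitive [- (u^2 + 1) exp(- u)].

    The speed of a curve [c] is therefore the absolute value of the derivative of
    [f = 2 ln c].  The distance is attained by the geometric interpolation of the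
    end points.  For the lower bound one needs [|f b - f a| <= \int |f'|] when
    [f'] exists off finitely many points but need be neither continuous nor
    integrable.  Cover each level set [{k eps <= |f'| < (k + 1) eps}] by an open
    set [U_k] of nearly the same measure, and let [nu] be the sum of the Lebesgue
    measures on the [U_k] weighted by [(k + 1) eps].  Near every point the
    increments of [f] to the right are at most those of [nu], so a supremum
    argument gives [|f b - f a| <= nu [a, b[], and the mass of [nu] is at most
    [\int |f'|] up to a multiple of [eps]. *)

(** * Increments of a function and the integral of its derivative *)

Lemma increment_le_measure {R : realType}
    (nu : {measure set (measurableTypeR R) -> \bar R}) (f : R -> R)
    (a b : R) : a <= b -> continuous f ->
  (forall x, a <= x < b ->
     \forall y \near x^'+, (`|f y - f x|%:E <= nu `[x, y[%classic)%E) ->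
  (`|f b - f a|%:E <= nu `[a, b[%classic)%E.
Proof.
move=> ab cf step.
pose S := [set x | a <= x <= b /\ (`|f x - f a|%:E <= nu `[a, x[%classic)%E].
have Sa : S a.
  by split; rewrite ?lexx//= subrr normr0 measure_ge0.
have supS : has_sup S.
  by split; [exists a|exists b => x [/andP[]]].
set s := sup S.
have sa : a <= s by apply: ub_le_sup => //; exact: supS.2.
have sb : s <= b by apply: ge_sup; [exists a|move=> x [/andP[]]].
(* The bound passes to the supremum: if it failed, [nu] of [[a, s[] would be finite and, by
   continuity of [f], still exceeded near [s], yet [S] has points [x] there and [nu] is monotone. *)
have Ss : (`|f s - f a|%:E <= nu `[a, s[%classic)%E.
  rewrite leNgt; apply/negP => lt_nu.
  have nu_fin : nu `[a, s[%classic \is a fin_num.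
    by rewrite ge0_fin_numE ?measure_ge0// (lt_trans lt_nu)// ltry.
  have lt_r : fine (nu `[a, s[%classic) < `|f s - f a|.
    by rewrite -lte_fin fineK.
  have near_s : \forall y \near s, fine (nu `[a, s[%classic) < `|f y - f a|.
    have cs : `|f y - f a| @[y --> s] --> `|f s - f a|.
      by apply: cvg_norm; apply: cvgB; [exact: cf|exact: cvg_cst].
    exact: (cvgr_gt _ cs).
  have [e /= e0 se] := near_s.
  have [x Sx xs] := sup_adherent e0 supS.
  have xs' : x <= s by apply: ub_le_sup => //; exact: supS.2.
  have := se x; rewrite /= -/s => /(_ _)/wrap[].
    by rewrite ger0_norm ?subr_ge0// ltrBlDl -ltrBlDr.
  rewrite -lte_fin fineK// ltNge => /negP; apply.
  have [_ /le_trans] := Sx; apply; apply: le_measure; rewrite ?inE//.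
  by move=> z /=; rewrite !in_itv/= => /andP[-> /lt_le_trans->].
have [|sltb] := leP b s; first by
  move=> bs; have <- : s = b by apply/eqP; rewrite eq_le sb.
exfalso.
(* Half-open intervals concatenate disjointly, so [step] at [s] would put points to the right of [s]
   into [S]. *)
have : \forall y \near s^'+, s < y /\ y <= s.
  near=> y; have sy : s < y by near: y; exact: nbhs_right_gt.
  split => //; apply: ub_le_sup; first exact: supS.2.
  split.
    by rewrite (le_trans sa (ltW sy))/=; near: y; exact: nbhs_right_le.
  have -> : `[a, y[%classic = `[a, s[ `|` `[s, y[.
    apply/seteqP; split => z /=; rewrite !in_itv/=; lra.
  rewrite measureU//; last first.
    apply/seteqP; split => z //= []; rewrite /= !in_itv/=; lra.
  rewrite (@le_trans _ _ (`|f s - f a|%:E + `|f y - f s|%:E)%E)//.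
    by rewrite -EFinD lee_fin -[f y - f a](subrKA (f s)) addrC ler_normD.
  apply: leeD => //; near: y; apply: step; rewrite sa sltb//.
by move=> /filter_ex[y [sy ys]]; rewrite ltNge ys in sy.
Unshelve. all: by end_near. Qed.

Lemma derivable_right_increment_le {R : realType} (f : R -> R) (x c : R) :
  derivable f x 1 -> `|derive1 f x| < c ->
  \forall y \near x^'+, `|f y - f x| <= c * (y - x).
Proof.
move=> dfx; rewrite derive1E => fc.
have := cvgr_lt _ (cvg_norm dfx) _ fc.
move=> [e /= e0 xe]; near=> y.
have xy : x < y by near: y; exact: nbhs_right_gt.
have yx0 : 0 < y - x by rewrite subr_gt0.
have : ball (0 : R) e (y - x).
  rewrite -ball_normE /= sub0r normrN gtr0_norm// ltrBlDl.
  by near: y; apply: nbhs_right_lt; rewrite ltrDl.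
move=> /xe /(_ (lt0r_neq0 yx0)) /=.
rewrite /GRing.scale/= mulr1 subrK normrM normfV (gtr0_norm yx0) => /ltW.
by rewrite mulrC ler_pdivrMr.
Unshelve. all: by end_near. Qed.

Lemma increment_le_integral_derive1_continuous {R : realType} (f : R -> R)
    (a b : R) : a < b -> continuous f ->
  (forall x, x \in `]a, b[ -> derivable f x 1) ->
  measurable_fun `]a, b[ (derive1 f) ->
  (`|f b - f a|%:E <=
     \int[lebesgue_measure]_(x in `]a, b[) `|derive1 f x|%:E)%E.
Proof.
move=> ab cf df mf'.
pose mu := @lebesgue_measure R.
have mD : measurable (`]a, b[%classic : set R) by exact: measurable_itv.
have muD : mu `]a, b[%classic = (b - a)%:E.
  by rewrite /mu lebesgue_measure_itv/= lte_fin ab -EFinB.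
have mg' : measurable_fun `]a, b[ (fun x => `|derive1 f x|).
  exact: measurableT_comp.
have mg : measurable_fun `]a, b[ (fun x => `|derive1 f x|%:E).
  exact/measurable_EFinP.
have mgD (eps : R) : measurable_fun `]a, b[ (fun x => (`|derive1 f x| + eps)%:E).
  exact/measurable_EFinP/measurable_funD.
(* Differentiability is known only inside []a, b[], so the argument starts at [a' > a], and
   continuity at [a] lets [a'] approach [a]. In the error, [eps * (b - a)] pays for rounding [|f'|]
   up to [c k], and [eps] for the excess of the [U k] over the [E k]. *)
suff key (eps : {posnum R}) : forall a', a < a' < b ->
   (`|f b - f a'|%:E <= \int[mu]_(x in `]a, b[) `|derive1 f x|%:E
     + (eps%:num * (b - a) + eps%:num)%:E)%E.
  apply/lee_addgt0Pr => e e0.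
  have ba1 : 0 < b - a + 1 by rewrite addr_gt0// subr_gt0.
  (* For this [eps] the error in [key] is exactly [e / 2]; the other half absorbs [f a - f a']. *)
  have eps0 : 0 < e / 2 / (b - a + 1) by rewrite !divr_gt0.
  have : \forall a' \near a^'+, [/\ a < a', a' < b & `|f a - f a'| < e / 2].
    near=> y; split.
    - by near: y; exact: nbhs_right_gt.
    - by near: y; exact: nbhs_right_lt.
    - near: y; have := cvg_at_right_filter (cf a).
      by move=> /cvgrPdist_lt; apply; rewrite divr_gt0.
  move=> /filter_ex[a' [aa' a'b fa']].
  have := key (PosNum eps0) a'; rewrite aa' a'b => /(_ erefl) /=.
  rewrite (_ : _ * (b - a) + _ = e / 2); last first.
    by rewrite -[X in _ + X]mulr1 -mulrDr divfK// gt_eqF.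
  move=> fb; apply: (@le_trans _ _ (`|f b - f a'|%:E + (e / 2)%:E)%E).
    rewrite -EFinD lee_fin -[f b - f a](subrKA (f a')).
    by rewrite (le_trans (ler_normD _ _))// lerD2l distrC ltW.
  by rewrite [in leRHS](splitr e) EFinD addeA leeD2r.
pose c k : R := k.+1%:R * eps%:num.
have c0 k : 0 < c k by rewrite mulr_gt0// ltr0n.
pose E k := `]a, b[ `&` (fun x => `|derive1 f x|) @^-1` `[k%:R * eps%:num, c k[.
have mE k : measurable (E k : set R).
  by apply: mg' => //; exact: measurable_itv.
have muE k : (mu (E k) < +oo)%E.
  rewrite (@le_lt_trans _ _ (mu `]a, b[%classic))//; last by rewrite muD ltry.
  by apply: le_measure; rewrite ?inE//; [exact: mE|exact: subIsetl].
(* Weighted by [c k], the excess allowed for [U k] is [eps / 2 ^ (k + 1)], and these sum to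
   [eps]. *)
pose d k : R := eps%:num / (2 ^ k.+1)%:R / c k.
have d0 k : 0 < d k by rewrite divr_gt0// divr_gt0// ltr0n expn_gt0.
have /choice[U HU] : forall k, exists U : set R,
    [/\ open U, E k `<=` U & (mu (U `\` E k) < (d k)%:E)%E].
  by move=> k; exact: lebesgue_regularity_outer.
have mU k : measurable (U k) by have [+ _ _] := HU k; exact: open_measurable.
pose nu : {measure set (measurableTypeR R) -> \bar R} :=
  mseries (fun k => mscale (NngNum (ltW (c0 k))) (mrestr mu (mU k))) 0.
have EU : \bigcup_k E k = `]a, b[%classic.
  apply/seteqP; split=> [x [k _ []]//|x Dx].
  exists (Num.truncn (`|derive1 f x| / eps%:num)) => //; split => //=.
  rewrite in_itv/= -ler_pdivlMr// -ltr_pdivrMr//.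
  by apply: truncn_itv; rewrite divr_ge0.
have tE : trivIset setT E.
  move=> i j _ _ [x [[_ Ei] [_ Ej]]]; move: Ei Ej; rewrite /= !in_itv/=.
  move=> /andP[iE Ei] /andP[jE Ej]; apply/eqP; rewrite eqn_leq.
  rewrite -(ltnS i) -(ltnS j) -!(ltr_nat R).
  rewrite -(ltr_pM2r (gt0 eps)) (le_lt_trans iE Ej).
  by rewrite -(ltr_pM2r (gt0 eps)) (le_lt_trans jE Ei).
move=> a' /andP[aa' a'b].
apply: (@le_trans _ _ (nu `[a', b[%classic)).
  apply: increment_le_measure => //; first exact: ltW.
  move=> x /andP[a'x xb].
  have Dx : x \in `]a, b[ by rewrite in_itv/= xb (lt_le_trans aa' a'x).
  have : (\bigcup_k E k) x by rewrite EU.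
  move=> [k _ Ekx]; have [oU EkU _] := HU k.
  have [e /= e0 xeU] : nbhs x (U k) by apply: open_nbhs_nbhs; split => //; exact: EkU.
  near=> y.
  have xy : x < y by near: y; exact: nbhs_right_gt.
  have xyU : `[x, y[ `<=` U k.
    move=> z /=; rewrite in_itv/= => /andP[xz zy]; apply: xeU => /=.
    rewrite distrC ger0_norm ?subr_ge0// ltrBlDl (lt_trans zy)//.
    by near: y; apply: nbhs_right_lt; rewrite ltrDl.
  (* A single term of [nu] suffices: [|f'(x)| < c k] since [x] is in [E k], and [[x, y[] lies in
     [U k], so the term is [c k * (y - x)]. *)
  apply: (@le_trans _ _ ((c k)%:E * mrestr mu (mU k) `[x, y[)%E).
    rewrite /mrestr (setIidl xyU) /mu lebesgue_measure_itv/=.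
    rewrite lte_fin xy -EFinB -EFinM lee_fin.
    near: y; apply: derivable_right_increment_le; first exact: df.
    by have [_ /=] := Ekx; rewrite in_itv/= => /andP[].
  rewrite /nu/= /mseries (@nneseriesD1 _ _ k)//=.
  by rewrite leeDl// nneseries_ge0.
apply: (@le_trans _ _ (\sum_(k <oo) (c k)%:E * mu (U k))%E).
  apply: lee_nneseries => [k _ _|k _]; first by rewrite mule_ge0// lee_fin ltW.
  rewrite /mscale/= /mrestr; apply: lee_wpmul2l.
    by rewrite lee_fin; exact: ltW (c0 k).
  apply: le_measure; rewrite ?inE//; last exact: mU.
  by apply: measurableI => //; exact: mU.
apply: (@le_trans _ _ (\sum_(k <oo)
    (((c k)%:E * mu (E k)) + (eps%:num / (2 ^ k.+1)%:R)%:E))%E).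
  apply: lee_nneseries => [k _ _|k _]; first by rewrite mule_ge0// lee_fin ltW.
  have [_ EkU dk] := HU k.
  have -> : mu (U k) = (mu (E k) + mu (U k `\` E k))%E.
    rewrite -[in LHS](setDUK EkU); apply: (measureU lebesgue_measure).
    - exact: mE.
    - by apply: measurableD; [exact: mU|exact: mE].
    - by rewrite setDIK.
  rewrite ge0_muleDr// leeD2l//.
  rewrite (_ : _ / _ = c k * d k); last by rewrite /d [RHS]mulrC divfK// gt_eqF.
  by rewrite (EFinM (c k)); apply: lee_wpmul2l; rewrite ?lee_fin ltW.
apply: (le_trans (epsilon_trick _ _ _)) => //.
  by move=> k; rewrite mule_ge0// lee_fin ltW.
rewrite EFinD addeA leeD2r//.
apply: (@le_trans _ _ (\sum_(k <oo)
    \int[mu]_(x in E k) (`|derive1 f x| + eps%:num)%:E)%E).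
  apply: lee_nneseries => [k _ _|k _]; first by rewrite mule_ge0// lee_fin ltW.
  rewrite -(integral_cst mu (mE k)); apply: ge0_le_integral => //.
  - exact: mE.
  - by move=> x _; rewrite lee_fin ltW.
  - by apply: measurable_funS (mgD _) => //; exact: subIsetl.
  - move=> x [_ /=]; rewrite in_itv/= => /andP[+ _].
    rewrite lee_fin /c -natr1; lra.
rewrite -ge0_integral_bigcup//; last by rewrite EU; exact: mgD.
rewrite EU; under eq_integral do rewrite EFinD.
rewrite ge0_integralD//.
by rewrite integral_cst// [X in (_ * X)%E]muD EFinM.
Unshelve. all: by end_near. Qed.

(** On []a, b[] the derivative is the pointwise limit of the difference quotients with steps
    [harmonic n], which are continuous on the whole line because [f] is. *)
Lemma measurable_derive1 {R : realType} (f : R -> R) (a b : R) :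
  continuous f -> (forall x, x \in `]a, b[ -> derivable f x 1) ->
  measurable_fun `]a, b[ (derive1 f).
Proof.
move=> cf df.
apply: (@measurable_fun_cvg _ (measurableTypeR R) R _
  (fun n (x : R) => (harmonic n)^-1 * (f (harmonic n + x) - f x))) => [n|x Dx].
  apply: measurable_funTS; apply: continuous_measurable_fun => x.
  apply: cvgM; first exact: cvg_cst.
  apply: cvgB; last exact: cf.
  apply: continuous_comp; last exact: cf.
  by apply: cvgD; [exact: cvg_cst|exact: cvg_id].
rewrite derive1E.
have := (cvg_at_rightP _ _ _).1 (cvg_dnbhs_at_right (df x Dx)) harmonic.
move=> /(_ (conj _ cvg_harmonic))/wrap[].
  by move=> n; rewrite harmonic_gt0.
by apply: cvg_trans; apply: near_eq_cvg; near=> n; rewrite /= /GRing.scale/= mulr1.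
Unshelve. all: by end_near. Qed.

(** Measurability is returned with the bound because gluing the pieces of a partition splits an
    integral, which requires it. *)
Lemma increment_le_integral_derive1 {R : realType} (f : R -> R) (a b : R) :
    a < b -> {within `[a, b], continuous f} ->
    (forall x, x \in `]a, b[ -> derivable f x 1) ->
  measurable_fun `]a, b[ (derive1 f) /\
  (`|f b - f a|%:E <=
     \int[lebesgue_measure]_(x in `]a, b[) `|derive1 f x|%:E)%E.
Proof.
move=> ab cf df.
(* [f] is only known on [a, b]; [f \o clamp] is a continuous extension. *)
pose clamp x := Num.max a (Num.min x b).
have clamp_in x : clamp x \in `[a, b].
  by rewrite in_itv/= /clamp le_max lexx/= ge_max (ltW ab)/= ge_min lexx orbT.
have clamp_id x : x \in `[a, b] -> clamp x = x.
  rewrite in_itv/= => /andP[ax xb].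
  by rewrite /clamp (min_idPl xb) (max_idPr ax).
have cclamp : continuous clamp.
  move=> x; apply: (continuous_max (f := fun=> a) (g := fun y => Num.min y b)).
    exact: cvg_cst.
  apply: (continuous_min (f := id) (g := fun=> b)); first exact: cvg_id.
  exact: cvg_cst.
pose g := f \o clamp.
have cg : continuous g.
  move=> x; rewrite /continuous_at /g /=.
  have /subspace_continuousP/(_ _ (clamp_in x)) := cf.
  apply: cvg_comp => A /= [e /= e0 eA].
  change (\forall y \near x, A (clamp y)); near=> y.
  apply: (eA _ _ (clamp_in y)); near: y.
  exact: (cclamp x _ (nbhsx_ballx _ _ e0)).
have gf x : x \in `]a, b[ -> \near x, f x = g x.
  move=> xab; near=> y; rewrite /g/= clamp_id//.
  by apply: subset_itv_oo_cc; near: y; exact: near_in_itvoo.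
have dg x : x \in `]a, b[ -> derivable g x 1.
  by move=> xab; apply: near_eq_derivable (df x xab); exact: gf.
have fg' x : x \in `]a, b[ -> derive1 g x = derive1 f x.
  by move=> xab; rewrite !derive1E; apply/esym/near_eq_derive/gf.
have mg := measurable_derive1 g a b cg dg.
split.
  by apply: eq_measurable_fun mg => x; rewrite inE => /fg'.
have -> : f b = g b by rewrite /g/= clamp_id// in_itv/= lexx ltW.
have -> : f a = g a by rewrite /g/= clamp_id// in_itv/= lexx ltW.
apply: le_trans (increment_le_integral_derive1_continuous g a b ab cg dg mg) _.
rewrite le_eqVlt; apply/orP; left; apply/eqP.
by apply: eq_integral => x /set_mem xab; rewrite fg'.
Unshelve. all: by end_near. Qed.

(** Induction on the break points. The integrand [w] will be the speed of a curve; it is tied to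
    [|f'|] only inside the pieces, since [f] may have no derivative at the break points. *)
Lemma increment_le_integral_itv_partition {R : realType} (f : R -> R)
    (w : R -> \bar R) (a b : R) (s : seq R) :
    itv_partition a b s -> {within `[a, b], continuous f} ->
    (forall x, 0 <= w x)%E ->
    (forall k, (k < size s)%N ->
       forall x, x \in `]nth 0 (a :: s) k, nth 0 (a :: s) k.+1[ ->
       derivable f x 1 /\ w x = `|derive1 f x|%:E) ->
  measurable_fun `[a, b] w /\
  (`|f b - f a|%:E <= \int[lebesgue_measure]_(x in `[a, b]) w x)%E.
Proof.
move=> + + w0; elim: s a => [a /itv_partition_nil <- _ _|h t IH a abs cf dfw].
  rewrite set_itv1 subrr normr0; split; first exact: measurable_fun_set1.
  exact: integral_ge0.
have hbt := itv_partition_cons abs.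
have ah : a < h by have [/= /andP[]] := abs.
have hb : h <= b := itv_partition_le hbt.
have [|k kt x|mhb lehb] := IH h hbt.
- by apply: continuous_subspaceW cf; apply: subset_itvr; rewrite bnd_simp ltW.
- exact: (dfw k.+1).
have [||mah leah] := @increment_le_integral_derive1 R f a h ah.
- by apply: continuous_subspaceW cf; apply: subset_itvl; rewrite bnd_simp.
- by move=> x xah; have [] := dfw 0%N (ltn0Sn _) x xah.
have wE x : x \in `]a, h[ -> w x = `|derive1 f x|%:E.
  by move=> xah; have [] := dfw 0%N (ltn0Sn _) x xah.
have mw : measurable_fun `]a, h[ w.
  apply: (@eq_measurable_fun _ _ (measurableTypeR R) _ _ (fun x => `|derive1 f x|%:E)).
    by move=> x /set_mem xah; rewrite wE.
  by apply/measurable_EFinP; exact: measurableT_comp.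
(* The value [w a] is unknown, so [a] is split off; as [w] is nonnegative, adding [a] to []a, h[]
   cannot decrease the integral. *)
have abE : `[a, b]%classic = [set a] `|` `]a, h[ `|` `[h, b].
  apply/seteqP; split => x /=; rewrite !in_itv/=.
    move=> /andP[]; rewrite le_eqVlt => /predU1P[->|ax xb]; first by left; left.
    by have [hx|xh] := leP h x; [right|left; right]; rewrite ?ax.
  move=> [[->|/andP[ax xh]]|/andP[hx xb]].
  - by rewrite lexx (le_trans (ltW ah)).
  - by rewrite (ltW ax) (le_trans (ltW xh)).
  - by rewrite (le_trans (ltW ah)).
have mab : measurable_fun `[a, b] w.
  rewrite abE; apply/measurable_funU => //; first exact: measurableU.
  split => //; apply/measurable_funU => //; split => //.
  exact: measurable_fun_set1.
split => //.
rewrite abE ge0_integral_setU//; last 3 first.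
- exact: measurableU.
- by rewrite -abE.
- apply/disj_setPS => x [/= [->|]]; rewrite /= !in_itv/=; lra.
apply: (@le_trans _ _ (`|f h - f a|%:E + `|f b - f h|%:E)%E).
  by rewrite -EFinD lee_fin -[f b - f a](subrKA (f h)) addrC ler_normD.
apply: leeD => //; apply: le_trans leah _.
have -> : (\int[lebesgue_measure]_(x in `]a, h[) `|derive1 f x|%:E =
    \int[lebesgue_measure]_(x in `]a, h[) w x)%E.
  by apply: eq_integral => x /set_mem xah; rewrite wE.
apply: ge0_subset_integral => //.
- exact: measurableU.
- by move: mab; rewrite abE => /measurable_funU[]//; exact: measurableU.
Qed.

(** * The score and the Fisher information *)

(** For [x > 0] the log-density is [ln x - 2 ln s - x^2 / (2 s^2)]. At [x = 0] the formula is false: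
    the density vanishes for every parameter and [ln 0 = 0], so the score is 0. *)
Lemma rayleigh_score {R : realType} (xi : 'rV[R]_1) (x : R) :
  0 < xi 0 0 -> 0 < x ->
  score (rayleigh R) 0 xi x = x ^+ 2 / xi 0 0 ^+ 3 - 2 / xi 0 0.
Proof.
move=> s0 x0; set s := xi 0 0 in s0 *.
(* In dimension one the partial derivative and the ordinary one have the same difference
   quotients. *)
have -> : score (rayleigh R) 0 xi x = 'D_1 (fun s => ln (rayleigh_pdf s x)) s.
  rewrite /score /derive.
  set dl := (fun h => _ *: _); set dr := (fun h => _ *: _).
  suff -> : dl = dr by [].
  by apply/funext => h; rewrite /dl /dr /= /rayleigh_density !mxE/=.
have sE : \forall t \near s, ln x - 2 * ln t - x ^+ 2 / 2 * (t^-1) ^+ 2 =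
    ln (rayleigh_pdf t x).
  near=> t; have t0 : 0 < t by near: t; exact: lt_nbhsr.
  rewrite /rayleigh_pdf lnM ?posrE ?expR_gt0 ?divr_gt0 ?exprn_gt0//.
  rewrite expRK ln_div ?posrE ?exprn_gt0// lnXn// mulr_natl; congr (_ - _).
  by field; rewrite gt_eqF.
rewrite -(near_eq_derive _ sE).
have lns := is_derive1_ln s0.
have invs : is_derive s 1 (fun t : R => t^-1) (- s ^- 2).
  have := @is_deriveV R id s 1 1 (lt0r_neq0 s0) (is_derive_id _ _).
  by rewrite /GRing.scale/= mulr1.
apply: derive_val.
rewrite [X in is_derive _ _ X _](_ : _ = cst (ln x) - 2 *: @ln R -
  (x ^+ 2 / 2) *: ((fun t => t^-1) ^+ 2 : R -> R)); last exact/funext.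
by apply: is_derive_eq; rewrite /GRing.scale/=; field; rewrite gt_eqF.
Unshelve. all: by end_near. Qed.

(** Makes the primitive of the Fisher integrand vanish at infinity. *)
Lemma cvg_sqrD1_expRN {R : realType} :
  (u ^+ 2 + 1) * expR (- u) @[u --> +oo] --> (0 : R).
Proof.
(* For [u >= 1], the bound [exp u >= 1 + u^3 / 6] gives [(12 / u) exp u >= 2 u^2 >= u^2 + 1]. *)
apply: (@squeeze_cvgr _ _ _ _ (fun=> 0) (fun u : R => 12 * u^-1)).
- near=> u; have u1 : 1 <= u by near: u; exact: nbhs_pinfty_ge.
  have u0 : 0 < u by rewrite (lt_le_trans _ u1).
  rewrite mulr_ge0 ?expR_ge0 ?addr_ge0 ?sqr_ge0//=.
  rewrite expRN ler_pdivrMr ?expR_gt0//.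
  have := expR_ge1Dxn 2 (ltW u0); rewrite (_ : 3`! = 6)%N// => exp_ge.
  apply: (@le_trans _ _ (12 * u^-1 * (1 + u ^+ 3 / 6))); last first.
    by rewrite ler_wpM2l// mulr_ge0// invr_ge0 ltW.
  rewrite (_ : _ * (_ + _) = 12 * u^-1 + 2 * u ^+ 2); last by field; rewrite gt_eqF.
  have : 0 <= u^-1 by rewrite invr_ge0 ltW.
  have := ler_pM ler01 ler01 u1 u1; rewrite -expr2; lra.
- exact: cvg_cst.
- rewrite -[X in _ --> X](mulr0 12); apply: cvgM; first exact: cvg_cst.
  apply: (gtr0_cvgV0 _).2; [exact: nbhs_pinfty_gt|exact: cvg_id].
Unshelve. all: by end_near. Qed.


Lemma rayleigh_fisher_matrix {R : realType} (xi : 'rV[R]_1) : 0 < xi 0 0 ->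
  fisher_matrix (rayleigh R) xi 0 0 = 4 / xi 0 0 ^+ 2.
Proof.
move=> s0; rewrite mxE /density_expectation /=; set s := xi 0 0 in s0 *.
pose u (x : R) : R := x ^+ 2 / (2 * s ^+ 2).
(* The substitution is built into this primitive in [x], so the integral is read off as
   [- F 0 = 4 / s^2]. *)
pose F (x : R) : R := - (4 / s ^+ 2) * ((u x ^+ 2 + 1) * expR (- u x)).
pose g (x : R) : R := (x ^+ 2 / s ^+ 3 - 2 / s) ^+ 2.
have cg : continuous g.
  move=> x; apply: (@continuous_comp _ _ _ (fun y : R => y ^+ 2 / s ^+ 3 - 2 / s)
    (@GRing.exp R ^~ 2)); last exact: exprn_continuous.
  apply: cvgB; last exact: cvg_cst.
  by apply: cvgM; [exact: exprn_continuous|exact: cvg_cst].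
have dF (x : R) : is_derive x 1 F (g x * rayleigh_pdf s x).
  have du : is_derive x 1 u (x / s ^+ 2).
    rewrite [X in is_derive _ _ X _](_ : _ =
      (2 * s ^+ 2)^-1 *: (@GRing.exp R ^~ 2)); last first.
      by apply/funext => y; rewrite /u /= mulrC.
    by apply: is_derive_eq; rewrite /GRing.scale/=; field; rewrite gt_eqF.
  have duN : is_derive x 1 (fun y => - u y) (- (x / s ^+ 2)).
    exact: is_deriveN.
  rewrite [X in is_derive _ _ X _](_ : _ = - (4 / s ^+ 2) *:
    ((u ^+ 2 + cst 1) * (fun y => expR (- u y)))); last exact/funext.
  apply: is_derive_eq; rewrite -[(_ + cst 1) x]/(u x ^+ 2 + 1).
  rewrite /GRing.scale/= /rayleigh_pdf /g /u.
  by field; rewrite gt_eqF.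
transitivity (\int[lebesgue_measure]_(x in `[0, +oo[) (g x * rayleigh_pdf s x)).
  apply: eq_Rintegral => x /set_mem.
  rewrite /rayleigh_sample/= in_itv/= andbT le_eqVlt => /predU1P[<-|x0].
    by rewrite /rayleigh_density /rayleigh_pdf !mul0r !mulr0.
  by rewrite !rayleigh_score// -expr2.
rewrite (@Rintegral_ge0_continuous_FTC2y _ _ F _ 0).
- by rewrite /F /u expr0n/= mul0r oppr0 expR0; ring.
- by move=> x x0; rewrite mulr_ge0 ?sqr_ge0 ?rayleigh_pdf_ge0.
- apply: continuous_subspaceT => x.
  by apply: cvgM; [exact: cg|exact: rayleigh_pdf_continuous].
- rewrite -[X in _ --> X](mulr0 (- (4 / s ^+ 2))); apply: cvgM; first exact: cvg_cst.
  apply: (cvg_comp u (fun u => (u ^+ 2 + 1) * expR (- u)) _ cvg_sqrD1_expRN).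
  apply: gt0_cvgMly; last exact: cvgr_expr2.
  by rewrite invr_gt0 mulr_gt0// exprn_gt0.
- by move=> x _; apply: ex_derive.
- apply: cvg_at_right_filter; apply: differentiable_continuous.
  by apply/derivable1_diffP; apply: ex_derive.
- by move=> x _; rewrite derive1E; apply: derive_val.
Qed.

(** * Speed and length of curves of parameters *)

(** The quadratic form is the square of [2 v / s], the differential of [2 ln s], which is thus an
    arc length coordinate. *)
Lemma rayleigh_speed {R : realType} (xi v : 'rV[R]_1) : 0 < xi 0 0 ->
  Num.sqrt ((v *m fisher_matrix (rayleigh R) xi *m v^T) 0 0) =
  2 * `|v 0 0 / xi 0 0|.
Proof.
move=> xi0; rewrite mxE big_ord1 mxE big_ord1 rayleigh_fisher_matrix// mxE.
have -> : v 0 0 * (4 / xi 0 0 ^+ 2) * v 0 0 = (2 * (v 0 0 / xi 0 0)) ^+ 2.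
  by field; rewrite gt_eqF.
by rewrite sqrtr_sqr normrM ger0_norm.
Qed.

Lemma derivable_derivable_within {R : realType} {d : nat} (D : set R)
    (c : R -> 'rV[R]_d) (t : R) :
  derivable c t 1 -> derivable_within D c t.
Proof.
move=> /cvg_ex[/= l cl]; apply/cvg_ex; exists l => A /cl[e /= e0 eA].
exists e => //= s es st _; have := eA (s - t).
rewrite /= /ball_/= sub0r normrN distrC es => /(_ erefl).
by rewrite subr_eq0 => /(_ st); rewrite /GRing.scale/= mulr1 subrK.
Qed.

(** A ball around [t] inside [D] makes the restriction to [D] void. This recovers ordinary
    derivatives inside the closed pieces of a curve. *)
Lemma derivable_within_interior {R : realType} {d : nat} (D : set R)
    (c : R -> 'rV[R]_d) (t : R) :
  nbhs t D -> derivable_within D c t -> derivable c t 1.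
Proof.
move=> [r /= r0 rD] /cvg_ex[/= l cl]; apply/cvg_ex; exists l => A /cl[e /= e0 eA].
exists (Num.min r e) => /=; first by rewrite lt_min r0.
move=> h /=; rewrite /ball_/= sub0r normrN lt_min => /andP[hr he] h0.
have := eA (h + t); rewrite /= /ball_/= opprD addrCA subrr addr0 normrN he.
move=> /(_ erefl); rewrite -subr_eq0 addrK => /(_ h0).
rewrite /GRing.scale/= mulr1; apply; apply: rD.
by rewrite /= /ball_/= opprD addrCA subrr addr0 normrN.
Qed.

(** The speed equals [|f'|] for [f = 2 ln c] inside each piece, so the partition inequality applies
    to [f] with the speed as [w]. *)
Lemma rayleigh_curve_length_ge {R : realType} (c : R -> 'rV[R]_1) (s1 s2 : R) :
  curve_between (rayleigh R) (const_mx s1) (const_mx s2) c ->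
  ((2 * `|ln s1 - ln s2|)%:E <= curve_length (rayleigh R) c)%E.
Proof.
move=> [[cc [s part dc]] cpos c0 c1].
pose f t := 2 * ln (c t 0 0).
have cgt0 t : t \in `[0, 1] -> 0 < c t 0 0.
  by rewrite in_itv/=; exact: cpos.
have -> : 2 * `|ln s1 - ln s2| = `|f 1 - f 0|.
  by rewrite /f c0 c1 !mxE -mulrBr normrM ger0_norm// distrC.
apply: (increment_le_integral_itv_partition f _ 0 1 s part _ _ _).2.
- apply/subspace_continuousP => x x01; apply: cvgM; first exact: cvg_cst.
  apply: (@cvg_comp _ _ _ (fun t => c t 0 0) (@ln R) _
    (nbhs (c x 0 0))); last exact/continuous_ln/cgt0.
  apply: (@cvg_comp _ _ _ c (fun v : 'rV[R]_1 => v 0 0) _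
    (nbhs (c x))); last exact: coord_continuous.
  exact: ((subspace_continuousP _ _).1 cc).
- by move=> x; rewrite lee_fin sqrtr_ge0.
- move=> k ks x xk.
  have x01 : x \in `[0, 1].
    (* The bounds on break points use the default value 1 for [nth], the curve definition uses 0;
       both indices are in range, so they agree. *)
    have := itv_partition_nth_le (m := k.+1) ks part.
    have := itv_partition_nth_ge (m := k) (leqW ks) part.
    rewrite !(set_nth_default 0 1)/= ?ltnS//; last exact: ltnW.
    move: xk; rewrite !in_itv/= => /andP[kx xk] k0 k1.
    by rewrite (le_trans k0 (ltW kx)) (le_trans (ltW xk) k1).
  have dcx : derivable c x 1.
    apply: derivable_within_interior (dc k ks x _).
      by apply: filterS (near_in_itvoo xk) => y; exact: subset_itv_oo_cc.
    exact: subset_itv_oo_cc xk.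
  have dcx0 : is_derive x 1 (fun t => c t 0 0) (derive1 c x 0 0).
    rewrite derive1E derive_mx// mxE; apply: derivableP.
    exact: (derivable_mxP _ _ _).1.
  have df : is_derive x 1 f (2 * (derive1 c x 0 0 / c x 0 0)).
    have lnc := is_derive1_ln (cgt0 x x01).
    rewrite [X in is_derive _ _ X _](_ : _ = 2 *: (@ln R \o (fun t => c t 0 0)))//.
    have := is_deriveZ 2 (is_derive1_comp lnc dcx0).
    by rewrite /GRing.scale/= [_^-1 * _]mulrC.
  have [dfx f'E] := df; split => //.
  by rewrite (derive1E f) f'E rayleigh_speed ?cgt0// [in RHS]normrM ger0_norm.
Qed.

(** The curve is [s1 (s2 / s1)^t]; its logarithmic derivative is the constant [L], so its speed is
    constantly [2 |L|]. *)
Lemma rayleigh_curve_length_geodesic {R : realType} (s1 s2 : R) :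
    0 < s1 -> 0 < s2 ->
  exists2 c, curve_between (rayleigh R) (const_mx s1) (const_mx s2) c &
    curve_length (rayleigh R) c = (2 * `|ln s1 - ln s2|)%:E.
Proof.
move=> s10 s20; pose L := ln s2 - ln s1; pose r t := s1 * expR (t * L).
have r0 t : 0 < r t by rewrite mulr_gt0// expR_gt0.
have dr (t : R) : is_derive t 1 r (r t * L).
  have dtL : is_derive t 1 (fun u => u * L) L.
    rewrite [X in is_derive _ _ X _](_ : _ = L *: id); last first.
      by apply/funext => u /=; rewrite mulrC.
    by apply: is_derive_eq; rewrite /GRing.scale/= mulr1.
  rewrite [X in is_derive _ _ X _](_ : _ = s1 *: (@expR R \o (fun u => u * L)))//.
  by apply: is_derive_eq; rewrite /GRing.scale/= /r mulrA.
pose c t : 'rV[R]_1 := const_mx (r t).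
have dc t : derivable c t 1.
  apply/derivable_mxP => i j; rewrite (_ : (fun _ => _) = r); last first.
    by apply/funext => u; rewrite mxE.
  exact: ex_derive.
have dcE t : derive1 c t 0 0 = r t * L.
  rewrite derive1E derive_mx// mxE (_ : (fun _ => _) = r) ?derive_val//.
  by apply/funext => u; rewrite mxE.
exists c.
  split.
  - split.
      apply: continuous_subspaceT => t; apply: differentiable_continuous.
      exact/derivable1_diffP.
    (* The curve is differentiable on the whole line, so one piece is enough. *)
    exists [:: 1]; first exact: itv_partition1.
    by move=> k _ D t _; exact: derivable_derivable_within.
  - by move=> t _; rewrite /= /rayleigh_params/= mxE.
  - by rewrite /c /r mul0r expR0 mulr1.
  - rewrite /c /r mul1r expRD expRN !lnK ?posrE//; congr const_mx.
    by field; rewrite gt_eqF.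
rewrite /curve_length (@eq_integral _ _ _ _ _ (cst (2 * `|ln s1 - ln s2|)%:E)).
  rewrite integral_cst// [X in (_ * X)%E](_ : _ = 1%E) ?mule1//.
  transitivity (lebesgue_measure (`[0, 1] : set R)) => //.
  by rewrite lebesgue_measure_itv/= lte_fin ltr01 -EFinB subr0.
move=> t _; rewrite rayleigh_speed ?dcE ?mxE//.
by rewrite mulrAC mulfV ?gt_eqF// mul1r distrC.
Qed.

Theorem mainTheorem2 (R : realType) :
  (forall sigma : R, 0 < sigma ->
     fisher_information (rayleigh R) (const_mx sigma) = 4 / sigma ^+ 2) /\
  (forall sigma1 sigma2 : R, 0 < sigma1 -> 0 < sigma2 ->
     fisher_rao_distance (rayleigh R) (const_mx sigma1) (const_mx sigma2) =
     (2 * `|ln sigma1 - ln sigma2|)%:E).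
Proof.
split=> [sigma s0|s1 s2 s10 s20].
  by rewrite /fisher_information rayleigh_fisher_matrix ?mxE.
apply/eqP; rewrite eq_le; apply/andP; split.
  have [c cb <-] := rayleigh_curve_length_geodesic s1 s2 s10 s20.
  by apply: ereal_inf_lbound; exists c.
by apply: le_ereal_inf_tmp => _ [c cb <-]; exact: rayleigh_curve_length_ge.
Qed.
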